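(* Fix $\bar P_0\in\mathcal{W}(\mathcal{X},\mathcal{D})$. Let $P_\odot,P\in\mathcal{L}(\bar P_0)$ and $P'\in\mathcal{J}(P_\odot)$ be arbitrarily chosen. Then $$D(P\|P')=D(P\|P_\odot)+D(P_\odot\|P'),$$ and $P_\odot$ verifies $$P_\odot=\operatorname*{arg\,min}_{P''\in\mathcal{L}(\bar P_0)}D(P''\|P')=\operatorname*{arg\,min}_{P''\in\mathcal{J}(P_\odot)}D(P\|P'').$$
   Context: All vertex sets are finite with at least two elements. $(\mathcal{Y},\mathcal{E})$ is a strongly connected digraph and $\kappa\colon\mathcal{Y}\to\mathcal{X}$ is a surjective map (lumping function); $\mathcal{S}_x=\kappa^{-1}(\{x\})$, $\mathcal{D}=\{(\kappa(y),\kappa(y')):(y,y')\in\mathcal{E}\}$. $\mathcal{W}(\mathcal{Y},\mathcal{E})$ is the set of row-stochastic matrices on $\mathcal{Y}$ that are strictly positive on $\mathcal{E}$ and zero outside $\mathcal{E}$ (similarly for $(\mathcal{X},\mathcal{D})$). $P\in\mathcal{W}(\mathcal{Y},\mathcal{E})$ is $\kappa$-lumpable if $\sum_{y'\in\mathcal{S}_{x'}}P(y_1,y')=\sum_{y'\in\mathcal{S}_{x'}}P(y_2,y')$ for all $x,x'\in\mathcal{X}$, $y_1,y_2\in\mathcal{S}_x$; the common value is $\kappa_\star P(x,x')$, and $\kappa_\star P\in\mathcal{W}(\mathcal{X},\mathcal{D})$. $\mathcal{W}_\kappa(\mathcal{Y},\mathcal{E})$ is the set of $\kappa$-lumpable elements.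 For $P_\odot\in\mathcal{W}_\kappa(\mathcal{Y},\mathcal{E})$, the canonical embedding is $\Lambda^{(P_\odot)}_\star\bar P(y,y')=\bar P(\kappa(y),\kappa(y'))\,\frac{P_\odot(y,y')}{\kappa_\star P_\odot(\kappa(y),\kappa(y'))}$ for $(y,y')\in\mathcal{E}$, and $0$ otherwise. Define $\mathcal{L}(\bar P_0)=\{P\in\mathcal{W}_\kappa(\mathcal{Y},\mathcal{E}):\kappa_\star P=\bar P_0\}$ and $\mathcal{J}(P_\odot)=\{\Lambda^{(P_\odot)}_\star\bar P:\bar P\in\mathcal{W}(\mathcal{X},\mathcal{D})\}$. The divergence is $D(P\|P')=\sum_{(y,y')\in\mathcal{E}}\pi(y)P(y,y')\log\frac{P(y,y')}{P'(y,y')}$, with $\pi$ the unique stationary distribution of $P$. *)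

(* Defs.v *)
From HB Require Import structures.
From mathcomp Require Import all_boot all_order all_algebra.
From mathcomp Require Import boolp classical_sets reals exp.

Set Implicit Arguments.
Unset Strict Implicit.
Unset Printing Implicit Defensive.

Import Order.TTheory GRing.Theory Num.Theory.
Local Open Scope classical_set_scope.
Local Open Scope ring_scope.

(* A digraph on a finite vertex set V is its edge relation E : rel V (loops are
   allowed); a matrix indexed by V is a function V -> V -> R. *)

Section Markov.
Variables (R : realType) (V : finType).
Implicit Types (E : rel V) (P Q : V -> V -> R) (p : V -> R).

Definition strongly_connected E : Prop := forall v w, connect E v w.

Definition row_stochastic P : Prop :=
  (forall v w, 0 <= P v w) /\ (forall v, \sum_w P v w = 1).

(* W(V, E) *)
Definition transition_matrices E : set (V -> V -> R) :=
  [set P | [/\ row_stochastic P,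
               forall v w, E v w -> 0 < P v w
             & forall v w, ~~ E v w -> P v w = 0]].

Definition is_stationary P p : Prop :=
  [/\ forall v, 0 <= p v,
      \sum_v p v = 1
    & forall w, \sum_v p v * P v w = p w].

(* A stationary distribution of P; it exists and is unique when P is in
   W(V, E) with (V, E) strongly connected.  The default value 0 is only taken
   if there is none. *)
Definition stationary P : V -> R := xget (fun=> 0) [set p | is_stationary P p].

Definition divergence E P Q : R :=
  \sum_(e : V * V | E e.1 e.2)
    stationary P e.1 * P e.1 e.2 * ln (P e.1 e.2 / Q e.1 e.2).

End Markov.

Section Lumping.
Variables (R : realType) (Y X : finType).
Implicit Types (E : rel Y) (kappa : Y -> X) (P : Y -> Y -> R)
  (Pbar : X -> X -> R).

Definition lumped_edges E kappa : rel X := fun x x' =>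
  [exists y, exists y', [&& E y y', kappa y == x & kappa y' == x']].

Definition lumpable kappa P : Prop :=
  forall (x x' : X) (y1 y2 : Y), kappa y1 = x -> kappa y2 = x ->
    \sum_(y' | kappa y' == x') P y1 y' = \sum_(y' | kappa y' == x') P y2 y'.

(* W_kappa(Y, E) *)
Definition lumpable_matrices E kappa : set (Y -> Y -> R) :=
  [set P | transition_matrices E P /\ lumpable kappa P].

(* kappa_* P, evaluated at an arbitrary representative y of the fibre over x;
   for lumpable P the value does not depend on y.  The None branch is void when
   kappa is surjective. *)
Definition lump kappa P : X -> X -> R := fun x x' =>
  if [pick y | kappa y == x] is Some y
  then \sum_(y' | kappa y' == x') P y y' else 0.

(* Lambda_*^(P0) Pbar *)
Definition canonical_embedding E kappa (P0 : Y -> Y -> R) Pbar : Y -> Y -> R :=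
  fun y y' =>
    if E y y' then
      Pbar (kappa y) (kappa y') *
        (P0 y y' / lump kappa P0 (kappa y) (kappa y'))
    else 0.

(* L(Pbar) *)
Definition lumping_fibre E kappa Pbar : set (Y -> Y -> R) :=
  [set P | lumpable_matrices E kappa P /\ lump kappa P = Pbar].

(* J(P0) *)
Definition embedding_range E kappa (P0 : Y -> Y -> R) : set (Y -> Y -> R) :=
  [set canonical_embedding E kappa P0 Pbar
     | Pbar in transition_matrices (lumped_edges E kappa)].

End Lumping.

(* The set of all minimizers of f over S. *)
Definition argmin (R : realType) (T : Type) (S : set T) (f : T -> R) : set T :=
  [set s | S s /\ forall t, S t -> f s <= f t].

(* Main.v *)
(* On an edge, Po(y, y') / P'(y, y') = Pbar0 / Pbar at (kappa y, kappa y') when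
   P' is the embedding of Pbar, so its logarithm only depends on the lumped edge.
   Since P and Po have the same lumping Pbar0, whose stationary distribution is
   unique, both push their edge measure pi(y) P(y, y') forward to that of Pbar0;
   hence D(P || P') - D(P || Po) = D(Po || P').  The two projections then follow
   from the Gibbs inequality D >= 0 and its equality case, which needs the
   stationary distribution to be positive. *)

Require Import Defs.
From HB Require Import structures.
From mathcomp Require Import all_boot all_order all_algebra.
From mathcomp Require Import boolp classical_sets reals exp.

Set Implicit Arguments.
Unset Strict Implicit.

Import Order.TTheory GRing.Theory Num.Theory.
Local Open Scope classical_set_scope.
Local Open Scope ring_scope.

(** * Invariant vectors, existence and uniqueness of stationary distributions *)

Section StationaryDistribution.
Variables (R : realType) (V : finType) (E : rel V) (P : V -> V -> R).

(** The triangle inequality makes each defect [d w'] nonnegative; as the rows of [P] sum to 1, the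
    defects sum to 0, so they all vanish. *)
Lemma invariant_norm (u : V -> R) :
  row_stochastic P -> (forall w, \sum_v u v * P v w = u w) ->
  forall w, \sum_v `|u v| * P v w = `|u w|.
Proof.
move=> [P0 P1] uP w.
pose d w' := \sum_v `|u v| * P v w' - `|u w'|.
have d_ge0 w' : 0 <= d w'.
  rewrite subr_ge0 -[u w']uP (le_trans (ler_norm_sum _ _ _))//.
  by apply: ler_sum => v _; rewrite normrM (ger0_norm (P0 _ _)).
have sum_d : \sum_w' d w' = 0.
  rewrite sumrB exchange_big/=; apply/eqP; rewrite subr_eq0; apply/eqP.
  by apply: eq_bigr => v _; rewrite -mulr_sumr P1 mulr1.
apply/eqP; rewrite -subr_eq0; apply/eqP.
exact: (psumr_eq0P (fun w' _ => d_ge0 w') sum_d).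
Qed.

Hypotheses (connE : strongly_connected E) (PW : transition_matrices E P).

(** Positivity spreads along an edge from [u] to [v], since [p u * P u v] is one of the nonnegative
    terms summing to [p v]; induction on a path from [v0] concludes. *)
Lemma nonneg_invariant_gt0 (p : V -> R) (v0 : V) :
  (forall v, 0 <= p v) -> (forall w, \sum_v p v * P v w = p w) ->
  0 < p v0 -> forall w, 0 < p w.
Proof.
have [[P0 _] Ppos _] := PW.
move=> p0 pP pv0 w; have /connectP[s] := connE v0 w.
elim: s v0 pv0 => [|v s IHs] u pu /=; first by move=> _ ->.
case/andP => Euv; apply: IHs; rewrite -pP (bigD1 u)//=.
rewrite ltr_pwDl ?mulr_gt0 ?Ppos// sumr_ge0// => i _.
by rewrite mulr_ge0.
Qed.

Lemma stationary_unique (p q : V -> R) :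
  is_stationary P p -> is_stationary P q -> p = q.
Proof.
move=> [p0 p1 pP] [q0 q1 qP]; have [Pst _ _] := PW.
pose u v := p v - q v.
have uP w : \sum_v u v * P v w = u w.
  rewrite /u -[in RHS]pP -[in RHS]qP -sumrB.
  by apply: eq_bigr => v _; rewrite mulrBl.
have su : \sum_v u v = 0 by rewrite sumrB p1 q1 subrr.
have absP := invariant_norm Pst uP.
(* The positive part [|u| + u] is invariant, hence everywhere positive as soon
   as it is somewhere nonzero; this is incompatible with [\sum_v u v = 0]. *)
have pospart v0 : ~~ (0 < u v0).
  apply/negP => uv0.
  have pos w : 0 < `|u w| + u w.
    apply: (nonneg_invariant_gt0 (p := fun v => `|u v| + u v) (v0 := v0)).
    - by move=> v; rewrite -lerBlDr sub0r -normrN ler_norm.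
    - move=> w'; rewrite -[in RHS]absP -[in RHS]uP -big_split.
      by apply: eq_bigr => v _; rewrite mulrDl.
    - by rewrite ltr_wpDl.
  have upos w : 0 < u w.
    have := pos w; case: (ltrP 0 (u w)) => // uw.
    by rewrite ler0_norm// addNr ltxx.
  have /(_ v0 isT)/eqP := psumr_eq0P (fun v _ => ltW (upos v)) su.
  by rewrite gt_eqF.
(* By [pospart], [- u] is nonnegative; having zero sum, it vanishes. *)
have sNu : \sum_v - u v = 0 by rewrite sumrN su oppr0.
apply: funext => v; apply/eqP; rewrite -subr_eq0 -oppr_eq0; apply/eqP.
have u_le0 w : 0 <= - u w by rewrite oppr_ge0 leNgt pospart.
exact: (psumr_eq0P (fun w _ => u_le0 w) sNu).
Qed.

End StationaryDistribution.

Lemma sum_enum_val (R : nmodType) (T : finType) (F : T -> R) :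
  \sum_(i < #|T|) F (enum_val i) = \sum_t F t.
Proof. by rewrite [RHS](reindex _ (onW_bij _ (enum_val_bij T))). Qed.

(* 1 is a right eigenvalue of [P], with constant eigenvector, hence also a left
   one; by [invariant_norm] the absolute value of a left eigenvector is again
   invariant, so that it only remains to normalise it. *)
Lemma stationary_exists (R : realType) (V : finType) (P : V -> V -> R)
  (v0 : V) : row_stochastic P -> exists p, is_stationary P p.
Proof.
move=> Pst; have [P0 P1] := Pst.
pose A := \matrix_(i < #|V|, j < #|V|) P (enum_val i) (enum_val j).
have /eqP/det0P[x x0 xM] : \det (A - 1%:M) = 0.
  (* [det0P] speaks of row vectors in the left kernel, so the constant right eigenvector is used on
     the transpose; [v0] shows that it is nonzero. *)
  rewrite -det_tr; apply/eqP/det0P; exists (const_mx 1).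
    apply/eqP => /rowP /(_ (enum_rank v0)); rewrite !mxE.
    by apply/eqP; rewrite oner_eq0.
  rewrite linearB/= trmx1 mulmxBr mulmx1; apply/eqP; rewrite subr_eq0.
  apply/eqP/rowP => i; rewrite !mxE -[RHS](P1 (enum_val i)) -[RHS]sum_enum_val.
  by apply: eq_bigr => j _; rewrite !mxE mul1r.
pose u v := x 0 (enum_rank v).
have uP w : \sum_v u v * P v w = u w.
  move/eqP: xM; rewrite mulmxBr mulmx1 subr_eq0 => /eqP.
  move=> /rowP/(_ (enum_rank w)); rewrite mxE /u => <-.
  rewrite -[LHS]sum_enum_val; apply: eq_bigr => i _.
  by rewrite mxE enum_rankK enum_valK.
have absP := invariant_norm Pst uP.
pose s := \sum_v `|u v|.
have s_ge0 : 0 <= s by apply: sumr_ge0.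
have s_neq0 : s != 0.
  apply: contraNneq x0 => /psumr_eq0P s0; apply/eqP/rowP => i.
  have /eqP := s0 (fun _ _ => normr_ge0 _) (enum_val i) isT.
  by rewrite normr_eq0 /u enum_valK mxE => /eqP.
exists (fun v => `|u v| / s); split=> [v||w].
- by rewrite divr_ge0.
- by rewrite -mulr_suml divff.
- rewrite -[in RHS]absP mulr_suml; apply: eq_bigr => v _.
  by rewrite mulrAC.
Qed.

Section StationaryTheory.
Variables (R : realType) (V : finType) (E : rel V) (P : V -> V -> R).
Hypotheses (connE : strongly_connected E) (PW : transition_matrices E P).

Lemma stationaryP (v0 : V) : is_stationary P (stationary P).
Proof.
have [Pst _ _] := PW; have [p pst] := stationary_exists v0 Pst.
exact: (xgetPex (fun=> 0) (ex_intro [set q | is_stationary P q] p pst)).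
Qed.

Lemma stationary_eq (p : V -> R) : is_stationary P p -> stationary P = p.
Proof.
move=> pst; apply: xget_unique => // q qst.
exact: (stationary_unique connE PW).
Qed.

(** Entries summing to 1 cannot all vanish, and strong connectivity spreads one positive entry
    everywhere. *)
Lemma stationary_gt0 (v : V) : 0 < stationary P v.
Proof.
have [p0 p1 pP] := stationaryP v.
have /existsP[w pw] : [exists w, 0 < stationary P w].
  apply: contraT => /existsPn p_le0; move: p1; rewrite big1 => [/esym/eqP|w _].
    by rewrite oner_eq0.
  by apply/eqP; rewrite eq_le p0 andbT leNgt p_le0.
exact: (nonneg_invariant_gt0 connE PW _ _ pw).
Qed.

End StationaryTheory.

(** * Gibbs' inequality for the divergence *)

Section Divergence.
Variable R : realType.

(** This is [ln t <= t - 1] at [t = b / a], scaled by [a]; equality forces [ln t = 0] because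
    [1 + x < expR x] for nonzero [x]. *)
Lemma sub_le_mul_ln (a b : R) : 0 < a -> 0 < b ->
  a - b <= a * ln (a / b) ?= iff (a == b).
Proof.
move=> a0 b0; have ba0 : 0 < b / a by rewrite divr_gt0.
have -> : a - b = a * (1 - b / a)
  by rewrite mulrBr mulr1 mulrCA divff ?mulr1 ?gt_eqF.
have -> : ln (a / b) = - ln (b / a).
  by rewrite -[a / b]invf_div lnV// posrE.
have le1 : 1 - b / a <= - ln (b / a).
  rewrite lerBlDr -lerBlDl opprK addrC -[leRHS]lnK ?posrE// addrC.
  exact: expR_ge1Dx.
split; first by rewrite ler_pM2l.
rewrite (inj_eq (mulfI (lt0r_neq0 a0))).
apply/eqP/eqP => [eq1|->]; last by rewrite divff ?gt_eqF// ln1 subrr oppr0.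
have [ln0|/expR_gt1Dx] := eqVneq (ln (b / a)) 0.
  have := lnK (x := b / a); rewrite posrE => /(_ ba0); rewrite ln0 expR0.
  by move=> /esym/divr1_eq.
by rewrite lnK ?posrE// -[ln _]opprK -eq1 opprB addrC subrK ltxx.
Qed.

Variables (V : finType) (E : rel V).
Hypothesis connE : strongly_connected E.

Lemma sum_edges (F : V -> V -> R) : (forall v w, ~~ E v w -> F v w = 0) ->
  \sum_(e : V * V | E e.1 e.2) F e.1 e.2 = \sum_v \sum_w F v w.
Proof.
move=> F0; rewrite pair_bigA/= [RHS](bigID (fun e : V * V => E e.1 e.2))/=.
by rewrite [X in _ + X]big1 ?addr0// => e; apply: F0.
Qed.

Lemma divergence_ge0_eq0 (P Q : V -> V -> R) :
  transition_matrices E P -> transition_matrices E Q ->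
  0 <= divergence E P Q /\ (divergence E P Q = 0 -> P = Q).
Proof.
move=> PW QW; have [[_ P1] Ppos P0] := PW; have [[_ Q1] Qpos Q0] := QW.
have pi_gt0 := stationary_gt0 connE PW.
(* Subtracting [P v w - Q v w] leaves the weighted total unchanged, as both rows sum to 1, and makes
   every term nonnegative. *)
pose defect v w := P v w * ln (P v w / Q v w) - (P v w - Q v w).
have defect_ge0 (e : V * V) : E e.1 e.2 ->
    0 <= stationary P e.1 * defect e.1 e.2.
  move=> Ee; apply: mulr_ge0; first exact: ltW; rewrite subr_ge0.
  by rewrite sub_le_mul_ln ?Ppos ?Qpos.
have divE : divergence E P Q =
    \sum_(e : V * V | E e.1 e.2) stationary P e.1 * defect e.1 e.2.
  pose F v w := stationary P v * (P v w - Q v w).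
  have sumF : \sum_(e : V * V | E e.1 e.2) F e.1 e.2 = 0.
    rewrite sum_edges => [|v w Evw]; last by rewrite /F P0 ?Q0// subrr mulr0.
    by apply: big1 => v _; rewrite -mulr_sumr sumrB P1 Q1 subrr mulr0.
  rewrite /divergence -[LHS]subr0 -[X in _ - X = _]sumF -sumrB.
  apply: eq_bigr => e _.
  by rewrite /F /defect [RHS]mulrBr mulrA.
rewrite divE; split=> [|sum0]; first exact: sumr_ge0.
apply: funext => v; apply: funext => w.
have [Evw|Evw] := boolP (E v w); last by rewrite P0 ?Q0.
have /(_ (v, w) Evw)/eqP := psumr_eq0P defect_ge0 sum0.
rewrite mulf_eq0 gt_eqF//= /defect subr_eq0 eq_sym.
by rewrite (sub_le_mul_ln (Ppos _ _ Evw) (Qpos _ _ Evw)) => /eqP.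
Qed.

End Divergence.

(** * Lumped chains, canonical embeddings and the Pythagorean identity *)

Section Lumping.
Variables (R : realType) (Y X : finType) (E : rel Y) (kappa : Y -> X).

Lemma lumpE (P : Y -> Y -> R) y x' : lumpable kappa P ->
  \sum_(y' | kappa y' == x') P y y' = lump kappa P (kappa y) x'.
Proof.
move=> Pl; rewrite /lump; case: pickP => [z /eqP zy|/(_ y)].
  exact: Pl.
by rewrite eqxx.
Qed.

Lemma lumped_edge y y' : E y y' -> lumped_edges E kappa (kappa y) (kappa y').
Proof.
by move=> Eyy'; apply/existsP; exists y; apply/existsP; exists y'; apply/and3P.
Qed.

Lemma lumped_strongly_connected : (forall x, exists y, kappa y = x) ->
  strongly_connected E -> strongly_connected (lumped_edges E kappa).
Proof.
move=> surj connE x x'; have [y <-] := surj x; have [y' <-] := surj x'.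
have /connectP[s] := connE y y'.
elim: s y => [|z s IHs] y /=; first by move=> _ ->.
case/andP => Eyz Es y's; apply: connect_trans (IHs _ Es y's).
exact/connect1/lumped_edge.
Qed.

(** Change of variables for the edge measure: once both ends are grouped by fibres, the inner sum of
    [P] is the same for all [y] in a fibre, so [p] can be summed separately. *)
Lemma sum_lump (P : Y -> Y -> R) (p : Y -> R) (f : X -> X -> R) :
  lumpable kappa P ->
  \sum_y \sum_y' p y * P y y' * f (kappa y) (kappa y') =
  \sum_x \sum_x' (\sum_(y | kappa y == x) p y) * lump kappa P x x' * f x x'.
Proof.
move=> Pl; rewrite (partition_big kappa predT)//=; apply: eq_bigr => x _.
rewrite exchange_big/=; under [RHS]eq_bigr do rewrite -mulrA mulr_suml.
rewrite [LHS](partition_big kappa predT)//=; apply: eq_bigr => x' _.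
rewrite exchange_big/=; apply: eq_bigr => y /eqP <-.
rewrite -lumpE// mulr_suml mulr_sumr.
by apply: eq_bigr => y' /eqP <-; rewrite mulrA.
Qed.

Lemma is_stationary_lump (P : Y -> Y -> R) (p : Y -> R) : lumpable kappa P ->
  is_stationary P p ->
  is_stationary (lump kappa P) (fun x => \sum_(y | kappa y == x) p y).
Proof.
move=> Pl [p0 p1 pP]; split=> [x||x'].
- exact: sumr_ge0.
- by rewrite -p1 [RHS](partition_big kappa predT).
- under [RHS]eq_bigr do rewrite -pP.
  rewrite exchange_big/= [RHS](partition_big kappa predT)//=.
  apply: eq_bigr => x _; rewrite mulr_suml; apply: eq_bigr => y /eqP <-.
  by rewrite -mulr_sumr lumpE.
Qed.

Hypotheses (connE : strongly_connected E)
  (surj_kappa : forall x, exists y, kappa y = x).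
Variable Pbar0 : X -> X -> R.
Hypothesis Pbar0W : transition_matrices (lumped_edges E kappa) Pbar0.

(** The stationary distribution of [P] pushes forward to one of [Pbar0], which is unique; hence all
    members of the fibre give lumped edge functions the same mean. *)
Lemma lumping_fibre_sum (P : Y -> Y -> R) (f : X -> X -> R) :
  lumping_fibre E kappa Pbar0 P ->
  \sum_(e : Y * Y | E e.1 e.2)
    stationary P e.1 * P e.1 e.2 * f (kappa e.1) (kappa e.2) =
  \sum_x \sum_x' stationary Pbar0 x * Pbar0 x x' * f x x'.
Proof.
move=> [[PW Pl] lumpP]; have [_ _ P0] := PW.
pose F y y' := stationary P y * P y y' * f (kappa y) (kappa y').
rewrite (sum_edges (F := F)) => [|y y' Eyy'].
  rewrite sum_lump// lumpP; apply: eq_bigr => x _; apply: eq_bigr => x' _.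
  (* [y] witnesses that [Y] is nonempty, as [stationaryP] requires. *)
  have [y _] := surj_kappa x.
  have connX := lumped_strongly_connected surj_kappa connE.
  have := is_stationary_lump Pl (stationaryP PW y); rewrite lumpP.
  by move=> /(stationary_eq connX Pbar0W) ->.
by rewrite /F P0// mulr0 mul0r.
Qed.

Variable Po : Y -> Y -> R.
Hypothesis hPo : lumping_fibre E kappa Pbar0 Po.

Lemma canonical_embeddingE Pbar y y' : E y y' ->
  canonical_embedding E kappa Po Pbar y y' =
  Pbar (kappa y) (kappa y') * (Po y y' / Pbar0 (kappa y) (kappa y')).
Proof. by have [_ <-] := hPo; rewrite /canonical_embedding => ->. Qed.

(** Over the fibre of [x'], a row of the embedding is a row of [Po] rescaled by a constant, so its
    mass changes from [Pbar0 (kappa y) x'] to [Pbar (kappa y) x']. *)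
Lemma canonical_embedding_transition Pbar :
  transition_matrices (lumped_edges E kappa) Pbar ->
  transition_matrices E (canonical_embedding E kappa Po Pbar).
Proof.
move=> [[Pbar_ge0 Pbar1] Pbar_gt0 Pbar_eq0].
have [_ Pbar0_gt0 _] := Pbar0W.
have [[[[Po_ge0 _] Po_gt0 Po_eq0] Pol] lumpPo] := hPo.
have gt0 y y' : E y y' -> 0 < canonical_embedding E kappa Po Pbar y y'.
  move=> Eyy'; have Dyy' := lumped_edge Eyy'.
  rewrite canonical_embeddingE// mulr_gt0 ?Pbar_gt0//.
  by rewrite divr_gt0 ?Po_gt0 ?Pbar0_gt0.
have eq0 y y' : ~~ E y y' -> canonical_embedding E kappa Po Pbar y y' = 0.
  by rewrite /canonical_embedding => /negbTE->.
split=> //; split=> [y y'|y].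
  by have [/gt0/ltW|/eq0->] := boolP (E y y').
rewrite (partition_big kappa predT)//= -(Pbar1 (kappa y)).
apply: eq_bigr => x' _.
transitivity (\sum_(y' | kappa y' == x')
    Pbar (kappa y) x' / Pbar0 (kappa y) x' * Po y y').
  apply: eq_bigr => y' /eqP <-; have [Eyy'|nE] := boolP (E y y').
    by rewrite canonical_embeddingE// mulrA mulrAC.
  by rewrite eq0// Po_eq0// mulr0.
rewrite -mulr_sumr lumpE// lumpPo.
(* Off the lumped edges [Pbar0] is zero and cannot be cancelled; there [Pbar] vanishes too. *)
have [Dx|Dx] := boolP (lumped_edges E kappa (kappa y) x').
  by rewrite divfK// gt_eqF// Pbar0_gt0.
by rewrite Pbar_eq0// !mul0r.
Qed.

(** This places [Po] in its own embedding range, so that it competes in the second minimization. *)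
Lemma canonical_embedding_id : canonical_embedding E kappa Po Pbar0 = Po.
Proof.
have [_ Pbar0_gt0 _] := Pbar0W; have [[[_ _ Po_eq0] _] _] := hPo.
apply: funext => y; apply: funext => y'.
have [Eyy'|nE] := boolP (E y y').
  rewrite canonical_embeddingE// mulrC divfK//.
  by rewrite gt_eqF// Pbar0_gt0// lumped_edge.
by rewrite Po_eq0// /canonical_embedding (negbTE nE).
Qed.

Lemma divergence_pythagoras (P P' : Y -> Y -> R) :
  lumping_fibre E kappa Pbar0 P -> embedding_range E kappa Po P' ->
  divergence E P P' = divergence E P Po + divergence E Po P'.
Proof.
move=> hP [Pbar PbarW <-].
have [[_ Pbar_gt0 _] [_ Pbar0_gt0 _]] := (PbarW, Pbar0W).
have [[[_ Po_gt0 _] _] _] := hPo; have [[[_ P_gt0 _] _] _] := hP.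
pose f x x' := ln (Pbar0 x x' / Pbar x x').
have ratio y y' : E y y' ->
    Po y y' / canonical_embedding E kappa Po Pbar y y' =
    Pbar0 (kappa y) (kappa y') / Pbar (kappa y) (kappa y').
  move=> Eyy'; rewrite canonical_embeddingE// invfM invf_div.
  by rewrite mulrCA (mulrC (Po y y')) divfK 1?mulrC// gt_eqF// Po_gt0.
(* Averaging [f] under [Po] or under [P] gives the same value; with [P] in both terms, the identity
   holds edge by edge by additivity of [ln]. *)
have -> : divergence E Po (canonical_embedding E kappa Po Pbar) =
    \sum_(e : Y * Y | E e.1 e.2)
      stationary P e.1 * P e.1 e.2 * f (kappa e.1) (kappa e.2).
  rewrite lumping_fibre_sum// -(lumping_fibre_sum f hPo).
  by apply: eq_bigr => e Ee; rewrite ratio.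
rewrite -big_split; apply: eq_bigr => e Ee /=.
have De := lumped_edge Ee.
rewrite -mulrDr /f -ratio// -lnM ?posrE ?divr_gt0 ?P_gt0 ?Po_gt0//.
  by rewrite mulrA divfK// gt_eqF// Po_gt0.
by have [_ gt0 _] := canonical_embedding_transition PbarW; rewrite gt0.
Qed.

End Lumping.

Unset Implicit Arguments.

Theorem theorem6p2 (R : realType) (Y X : finType)
  (cardY : (1 < #|Y|)%N) (cardX : (1 < #|X|)%N)
  (E : rel Y) (connE : strongly_connected E)
  (kappa : Y -> X) (surj_kappa : forall x : X, exists y : Y, kappa y = x)
  (Pbar0 : X -> X -> R)
  (hPbar0 : transition_matrices (lumped_edges E kappa) Pbar0)
  (Po P P' : Y -> Y -> R)
  (hPo : lumping_fibre E kappa Pbar0 Po)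
  (hP : lumping_fibre E kappa Pbar0 P)
  (hP' : embedding_range E kappa Po P') :
  [/\ divergence E P P' = divergence E P Po + divergence E Po P',
      argmin (lumping_fibre E kappa Pbar0) (fun P'' => divergence E P'' P')
        = [set Po]
    & argmin (embedding_range E kappa Po) (fun P'' => divergence E P P'')
        = [set Po]].
Proof.
have pyth := divergence_pythagoras connE surj_kappa hPbar0 hPo.
have PoW : transition_matrices E Po by have [[]] := hPo.
have rangeW Q : embedding_range E kappa Po Q -> transition_matrices E Q.
  move=> [Pbar PbarW <-].
  exact: (canonical_embedding_transition hPbar0 hPo PbarW).
have PoJ : embedding_range E kappa Po Po.
  by exists Pbar0 => //; exact: canonical_embedding_id.
split; first exact: pyth.
(* Comparing a minimizer [Q] with [Po] through [pyth] leaves [divergence E Q Po <= 0], hence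
   [Q = Po]. *)
- apply/seteqP; split=> [Q [hQ minQ]|_ ->] /=.
    have [[QW _] _] := hQ.
    have [D0 D0eq] := divergence_ge0_eq0 connE QW PoW.
    apply: D0eq; apply/eqP; rewrite eq_le D0 andbT.
    by have := minQ _ hPo; rewrite (pyth Q)// gerDr.
  split=> // Q hQ; have [[QW _] _] := hQ.
  by rewrite (pyth Q)// lerDr; have [] := divergence_ge0_eq0 connE QW PoW.
(* Here [pyth] is applied with [Q] as second argument: minimality against [Po] leaves
   [divergence E Po Q <= 0]. *)
- apply/seteqP; split=> [Q [hQ minQ]|_ ->] /=.
    have [D0 D0eq] := divergence_ge0_eq0 connE PoW (rangeW _ hQ).
    apply/esym/D0eq/eqP; rewrite eq_le D0 andbT.
    by have := minQ _ PoJ; rewrite (pyth P Q)// gerDl.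
  split=> // Q hQ; rewrite (pyth P Q)// lerDl.
  by have [] := divergence_ge0_eq0 connE PoW (rangeW _ hQ).
Qed.
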